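(* Consider the problem of maximizing $$\int_0^T\big[-\langle c,\rho^2(t)\rangle+\langle p(t),S(I(t),p(t))\rangle\big]\,\sigma(t)\,dt$$ over $(p,I,\rho)$ subject to $\frac{dI}{dt}=-S(I,p)\,\sigma+\rho^2\sigma$ and boundary constraints $I(0)=I_0$, $I(T)=I_T$. If an optimal trajectory $(I(t),p(t),\rho(t))$ of this problem exists, then the quantity $$-\langle p-c,\ \rho^2\rangle+\Big\langle R,\ \Gamma^{-1}\Big(1_n-\frac{\rho^2}{S}\Big)\Big\rangle$$ is time invariant (constant in $t$) along it.
   Context: There are $n$ items and a time interval $[0,T]$. $I(t)=(I_1,\dots,I_n)$ is inventory, $p(t)=(p_1,\dots,p_n)$ price, $S=S(I,p)=(S_1,\dots,S_n)$ the rate of sales (demand), a given function of inventory and price with no explicit time dependence, $R=pS$ the revenue rate, $c=(c_1,\dots,c_n)$, $c_i\ge0$, the constant unit cost, and $\rho^2=(\rho_1^2,\dots,\rho_n^2)$ the de-seasoned replenishment rate. $\sigma(t)$ is a known probability density on $[0,T]$. Products, quotients and squares of vectors are componentwise; $\langle\cdot,\cdot\rangle$ is the standard scalar product; $1_n$ is the $n$-vector with all coordinates $1$. The cross-elasticity matrix is $\Gamma_{ij}=S_i^{-1}\frac{\partial S_i}{\partial p_j}p_j$, evaluated along the trajectory. Standing assumptions: all functions are sufficiently regular (differentiable); $I,p,S$ are positive along the trajectory (in the interior of the time interval); $\Gamma$ is invertible; and the Lagrange multiplier rule applies, i.e. an optimal trajectory admits a differentiable multiplier $\lambda(t)\in\mathbb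 R^n$ satisfying the Euler–Lagrange equations of the Lagrangian $L=-\langle c,\rho^2\rangle\sigma+\langle p,S\rangle\sigma+\langle\lambda,\tfrac{dI}{dt}+S\sigma-\rho^2\sigma\rangle$, namely $(c+\lambda)\rho=0$ (componentwise), $p+\lambda=-[(\partial S/\partial p)^T]^{-1}S$, and $\dot\lambda=\sigma(\partial S/\partial I)^T(p+\lambda)$. *)

(* Defs.v *)
From HB Require Import structures.
From mathcomp Require Import all_boot all_order all_algebra.
From mathcomp Require Import all_classical all_reals all_analysis.

Set Implicit Arguments.
Unset Strict Implicit.
Unset Printing Implicit Defensive.

Import Order.TTheory GRing.Theory Num.Theory.
Import numFieldNormedType.Exports.

Local Open Scope classical_set_scope.
Local Open Scope ring_scope.

Definition dotv (R : realType) (n : nat) (u v : 'cV[R]_n) : R :=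
  \sum_(i < n) u i 0 * v i 0.

Definition mulv (R : realType) (n : nat) (u v : 'cV[R]_n) : 'cV[R]_n :=
  \col_i (u i 0 * v i 0).

Definition divv (R : realType) (n : nat) (u v : 'cV[R]_n) : 'cV[R]_n :=
  \col_i (u i 0 / v i 0).

Definition posv (R : realType) (n : nat) (u : 'cV[R]_n) : Prop :=
  forall i, 0 < u i 0.

Definition is_density (R : realType) (T : R) (sigma : R -> R) : Prop :=
  [/\ measurable_fun `[0, T] sigma,
      forall t, t \in `[0, T] -> 0 <= sigma t &
      (\int[lebesgue_measure]_(t in `[0%R, T]) (sigma t)%:E = 1)%E].

(* The demand S takes the inventory I first and the price p second. *)

(* (dS_dI S I p) i j = dS_i/dI_j at (I, p) *)
Definition dS_dI (R : realType) (n : nat) (S : 'cV[R]_n -> 'cV[R]_n -> 'cV[R]_n)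
    (I p : 'cV[R]_n) : 'M[R]_n :=
  \matrix_(i, j) 'D_(delta_mx j 0) (fun J : 'cV[R]_n => S J p i 0) I.

(* (dS_dp S I p) i j = dS_i/dp_j at (I, p) *)
Definition dS_dp (R : realType) (n : nat) (S : 'cV[R]_n -> 'cV[R]_n -> 'cV[R]_n)
    (I p : 'cV[R]_n) : 'M[R]_n :=
  \matrix_(i, j) 'D_(delta_mx j 0) (fun q : 'cV[R]_n => S I q i 0) p.

Definition elasticity (R : realType) (n : nat)
    (S : 'cV[R]_n -> 'cV[R]_n -> 'cV[R]_n) (I p : 'cV[R]_n) : 'M[R]_n :=
  \matrix_(i, j) ((S I p i 0)^-1 * dS_dp S I p i j * p j 0).

(* The replenishment rate is the componentwise square of rho. *)
Record trajectory (R : realType) (n : nat) := Trajectory {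
  price : R -> 'cV[R]_n ;
  inventory : R -> 'cV[R]_n ;
  rho : R -> 'cV[R]_n }.

Section Problem.
Context (R : realType) (n : nat) (T : R) (c : 'cV[R]_n) (sigma : R -> R)
  (D : set ('cV[R]_n * 'cV[R]_n)) (S : 'cV[R]_n -> 'cV[R]_n -> 'cV[R]_n).
Implicit Types z w : trajectory R n.

Definition sales z (t : R) : 'cV[R]_n := S (inventory z t) (price z t).

Definition rho2 z (t : R) : 'cV[R]_n := mulv (rho z t) (rho z t).

Definition revenue z (t : R) : 'cV[R]_n := mulv (price z t) (sales z t).

Definition profit_rate z (t : R) : R :=
  (- dotv c (rho2 z t) + dotv (price z t) (sales z t)) * sigma t.

Definition objective z : \bar R :=
  (\int[lebesgue_measure]_(t in `[0%R, T]) (profit_rate z t)%:E)%E.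

(* D is the domain on which the demand function is given; the values of S
   outside D are irrelevant.  The integrability clause is what makes the
   objective meaningful. *)
Record admissible (I0 IT : 'cV[R]_n) z : Prop := {
  adm_inv_continuous : {within `[0, T], continuous (inventory z)} ;
  adm_derivable : forall t, t \in `]0, T[ ->
    [/\ derivable (price z) t 1, derivable (inventory z) t 1
      & derivable (rho z) t 1] ;
  adm_dom : forall t, t \in `]0, T[ -> D (inventory z t, price z t) ;
  adm_integrable :
    lebesgue_measure.-integrable `[0, T] (fun t => (profit_rate z t)%:E) ;
  adm_balance : forall t, t \in `]0, T[ ->
    'D_1 (inventory z) t = - (sigma t *: sales z t) + sigma t *: rho2 z t ;
  adm_start : inventory z 0 = I0 ;
  adm_end : inventory z T = IT }.

Definition optimal (I0 IT : 'cV[R]_n) z : Prop :=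
  admissible I0 IT z /\
  forall w, admissible I0 IT w -> (objective w <= objective z)%E.

(* Euler-Lagrange equations, with respect to rho, p and I respectively, of
   L = - <c, rho^2> sigma + <p, S> sigma
       + <lambda, dI/dt + S sigma - rho^2 sigma>. *)
Record euler_lagrange z (lambda : R -> 'cV[R]_n) : Prop := {
  el_derivable : forall t, t \in `]0, T[ -> derivable lambda t 1 ;
  el_rho : forall t, t \in `]0, T[ -> mulv (c + lambda t) (rho z t) = 0 ;
  el_price : forall t, t \in `]0, T[ ->
    price z t + lambda t =
      - (invmx (dS_dp S (inventory z t) (price z t))^T *m sales z t) ;
  el_inv : forall t, t \in `]0, T[ ->
    'D_1 lambda t =
      sigma t *: ((dS_dI S (inventory z t) (price z t))^T *m (price z t + lambda t)) }.

Definition invariant_quantity z (t : R) : R :=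
  - dotv (price z t - c) (rho2 z t)
  + dotv (revenue z t)
      (invmx (elasticity S (inventory z t) (price z t))
        *m (const_mx 1 - divv (rho2 z t) (sales z t))).

End Problem.

(* Main.v *)
(** Let mu = p + lambda and A = dS/dp.  Since Gamma = diag(1/S) A diag(p) and
    A^T mu = - S, the second term of the invariant equals <mu, rho^2 - S>; as
    (c + lambda) rho = 0, the whole quantity reduces to - <mu, S>.  In the
    derivative of <mu, S> the terms in dp/dt cancel because A^T mu = - S, and
    the balance and costate equations leave <dlambda/dt, rho^2>.  This vanishes:
    differentiate (c + lambda) rho = 0 and multiply by rho. *)

Require Import Defs.
From mathcomp Require Import all_boot all_order all_algebra.
From mathcomp Require Import all_classical all_reals all_analysis.
From mathcomp Require Import ring.
Import Order.TTheory GRing.Theory Num.Theory.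
Import numFieldNormedType.Exports.
Local Open Scope classical_set_scope.
Local Open Scope ring_scope.

(** * Algebra and differentiation of the scalar product *)

Section Dot.
Context (R : realType) (n : nat).
Implicit Types u v w : 'cV[R]_n.

Lemma dotvE u v : dotv u v = (u^T *m v) 0 0.
Proof. by rewrite mxE; apply: eq_bigr => i _; rewrite mxE. Qed.

Lemma dotvC u v : dotv u v = dotv v u.
Proof. by apply: eq_bigr => i _; rewrite mulrC. Qed.

Lemma dotvDl u v w : dotv (u + v) w = dotv u w + dotv v w.
Proof. by rewrite !dotvE linearD mulmxDl mxE. Qed.

Lemma dotvDr u v w : dotv w (u + v) = dotv w u + dotv w v.
Proof. by rewrite !dotvE mulmxDr mxE. Qed.

Lemma dotvNl u v : dotv (- u) v = - dotv u v.
Proof. by rewrite !dotvE linearN mulNmx mxE. Qed.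

Lemma dotvNr u v : dotv u (- v) = - dotv u v.
Proof. by rewrite !dotvE mulmxN mxE. Qed.

Lemma dotvZl a u v : dotv (a *: u) v = a * dotv u v.
Proof. by rewrite !dotvE linearZ -scalemxAl mxE. Qed.

Lemma dotvZr a u v : dotv u (a *: v) = a * dotv u v.
Proof. by rewrite !dotvE -scalemxAr mxE. Qed.

Lemma dotv_mulmxr (A : 'M[R]_n) u v : dotv u (A *m v) = dotv (A^T *m u) v.
Proof. by rewrite !dotvE trmx_mul trmxK mulmxA. Qed.

Lemma is_derive_coord {m k : nat} (f : R -> 'M[R]_(m, k)) (t : R) i j :
  derivable f t 1 -> is_derive t 1 (fun x => f x i j) ('D_1 f t i j).
Proof.
move=> df; rewrite derive_mx// mxE; apply: derivableP.
by move/derivable_mxP: df.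
Qed.

Lemma is_derive_dotv (f g : R -> 'cV[R]_n) (t : R) :
  derivable f t 1 -> derivable g t 1 ->
  is_derive t 1 (fun x => dotv (f x) (g x))
    (dotv ('D_1 f t) (g t) + dotv (f t) ('D_1 g t)).
Proof.
move=> df dg.
(* Written as a sum of products of functions, the scalar product falls under the sum and product
   rules for [is_derive]. *)
have -> : (fun x => dotv (f x) (g x)) =
    \sum_(i < n) ((fun x => f x i 0) * (fun x => g x i 0)).
  by apply/funext => x; rewrite fct_sumE.
rewrite -big_split/=; apply: is_derive_sum => i.
have dfi := is_derive_coord _ _ i 0 df.
have dgi := is_derive_coord _ _ i 0 dg.
by apply: is_derive_eq; rewrite addrC /GRing.scale/= [g t i 0 * _]mulrC.
Qed.

End Dot.

(** * Jacobians and the chain rule for the demand *)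

Section Chain.
Context (R : realType).

(** Expand [v] in the basis [delta_mx j 0]: by linearity, only the directional derivatives along
    basis vectors are left, and these are taken coordinatewise. *)
Lemma diff_col_jacobian {m n : nat} (G : 'cV[R]_m -> 'cV[R]_n) x v :
  differentiable G x ->
  'd G x v = (\matrix_(i, j) 'D_(delta_mx j 0) (fun y => G y i 0) x) *m v.
Proof.
move=> dG; apply/colP => i; rewrite mxE {1}[v]matrix_sum_delta.
under eq_bigr do rewrite big_ord1.
rewrite linear_sum summxE; apply: eq_bigr => j _.
rewrite linearZ mxE mxE [RHS]mulrC; congr (_ * _).
rewrite -deriveE// derive_mx ?mxE//; exact: diff_derivable.
Qed.

Context {n : nat} (S : 'cV[R]_n -> 'cV[R]_n -> 'cV[R]_n).

(** Split the direction as [(v, 0) + (0, w)]. Each half is the image of [v] or [w] under the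
    differential of a partial embedding, J to (J, p) or q to (I, q), so it is given by the Jacobian
    of the corresponding partial map. *)
Lemma diff_demand (I p v w : 'cV[R]_n) :
  differentiable (fun y : 'cV[R]_n * 'cV[R]_n => S y.1 y.2) (I, p) ->
  'd (fun y : 'cV[R]_n * 'cV[R]_n => S y.1 y.2) (I, p) (v, w) =
    dS_dI S I p *m v + dS_dp S I p *m w.
Proof.
set F := fun y => _ => dF.
have -> : (v, w) = (v, 0) + (0, w).
  by transitivity (v + 0, 0 + w); first rewrite addr0 add0r.
rewrite linearD; congr (_ + _).
- have di : is_diff I (fun J : 'cV[R]_n => (J, p)) (fun u => (u, 0)).
    exact: is_diff_pair.
  have dIp : differentiable (fun J : 'cV[R]_n => (J, p)) I by [].
  have dG : differentiable (F \o (fun J => (J, p))) I by exact: differentiable_comp.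
  have := diff_col_jacobian _ I v dG.
  by rewrite diff_comp//= diff_val.
- have di : is_diff p (fun q : 'cV[R]_n => (I, q)) (fun u => (0, u)).
    exact: is_diff_pair.
  have dIp : differentiable (fun q : 'cV[R]_n => (I, q)) p by [].
  have dG : differentiable (F \o (fun q => (I, q))) p by exact: differentiable_comp.
  have := diff_col_jacobian _ p w dG.
  by rewrite diff_comp//= diff_val.
Qed.

Lemma is_derive_demand (I p : R -> 'cV[R]_n) (t : R) :
  differentiable (fun y : 'cV[R]_n * 'cV[R]_n => S y.1 y.2) (I t, p t) ->
  derivable I t 1 -> derivable p t 1 ->
  is_derive t 1 (fun x => S (I x) (p x))
    (dS_dI S (I t) (p t) *m 'D_1 I t + dS_dp S (I t) (p t) *m 'D_1 p t).
Proof.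
move=> dS /derivable1_diffP dI /derivable1_diffP dp.
have dIp : differentiable (fun x => (I x, p x)) t by exact: differentiable_pair.
have dF := differentiable_comp dIp dS.
apply: DeriveDef; first exact/derivable1_diffP.
rewrite !deriveE// -diff_demand//.
(* [diff_comp] equates two linear maps; the derivative is their value at the direction 1. *)
by rewrite [LHS](congr1 (fun h => h 1) (diff_comp dIp dS))/= diff_pair.
Qed.

End Chain.

(** Both claims come from A diag(p) = diag(S) Gamma with A = dS/dp, where positivity makes the two
    diagonal matrices invertible. This trades the elasticity for A, the matrix in the price
    equation. *)
Lemma invmx_elasticity (R : realType) (n : nat)
    (S : 'cV[R]_n -> 'cV[R]_n -> 'cV[R]_n) (I p : 'cV[R]_n) :
  posv p -> posv (S I p) -> elasticity S I p \in unitmx ->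
  dS_dp S I p \in unitmx /\
  forall v, mulv p (invmx (elasticity S I p) *m v) =
    invmx (dS_dp S I p) *m mulv (S I p) v.
Proof.
move=> p0 S0 uG; set A := dS_dp S I p; set s := S I p in S0 *.
have GE : forall v, A *m mulv p v = mulv s (elasticity S I p *m v).
  move=> v; apply/colP => i; rewrite !mxE mulr_sumr; apply: eq_bigr => j _.
  by rewrite !mxE -!mulrA mulVKf ?lt0r_neq0// mulrA.
have uA : A \in unitmx.
  have -> : A = diag_mx s^T *m elasticity S I p *m diag_mx (map_mx GRing.inv p)^T.
    apply/matrixP => i j; rewrite mul_mx_diag mxE mul_diag_mx !mxE.
    by rewrite !mulrA mulfV ?lt0r_neq0// mul1r mulfK ?lt0r_neq0.
  rewrite !unitmx_mul uG andbT !unitmxE !det_diag !unitfE.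
  apply/andP; split; apply/prodf_neq0 => i _; rewrite !mxE ?invr_neq0//.
    by rewrite lt0r_neq0.
  by rewrite lt0r_neq0.
split=> // v; rewrite -[LHS](mulKmx uA) GE; congr (_ *m _).
by rewrite mulKVmx.
Qed.

(** * Consequences of the Euler-Lagrange equations *)

Section Invariant.
Context {R : realType} {n : nat} {T : R} {c : 'cV[R]_n} {sigma : R -> R}.
Context {D : set ('cV[R]_n * 'cV[R]_n)} {S : 'cV[R]_n -> 'cV[R]_n -> 'cV[R]_n}.
Context {z : trajectory R n} {lambda : R -> 'cV[R]_n}.
Lemma invariant_quantityE (t : R) : euler_lagrange T c sigma S z lambda -> t \in `]0, T[ ->
  posv (price z t) -> posv (sales S z t) ->
  elasticity S (inventory z t) (price z t) \in unitmx ->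
  invariant_quantity c S z t = - dotv (price z t + lambda t) (sales S z t).
Proof.
move=> el tT p0 S0 uG.
have [uA invG] := invmx_elasticity _ _ _ _ _ p0 S0 uG.
have c0 : dotv (c + lambda t) (rho2 z t) = 0.
  have /colP e0 := el_rho el tT.
  apply: big1 => i _; move: (e0 i); rewrite !mxE => e.
  by rewrite mulrA e mul0r.
have RE : forall v, dotv (revenue S z t) v = dotv (sales S z t) (mulv (price z t) v).
  by move=> v; apply: eq_bigr => i _; rewrite !mxE; ring.
have SE : mulv (sales S z t) (const_mx 1 - divv (rho2 z t) (sales S z t)) =
    sales S z t - rho2 z t.
  apply/colP => i; rewrite !mxE mulrBr mulr1 mulrCA mulfV ?mulr1//.
  exact/lt0r_neq0/S0.
have muE := el_price el tT.
(* The second term is now the product of A^-T S with S - rho^2, and the price equation identifies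
   A^-T S with -(p + lambda). *)
rewrite /invariant_quantity RE invG SE dotv_mulmxr trmx_inv.
rewrite -[X in dotv X (sales _ _ _ - _)]opprK -muE.
move: c0; rewrite !(dotvDl, dotvDr, dotvNl, dotvNr) => c0.
(* The zero added on the right is <c + lambda, rho^2>. *)
by rewrite -[RHS]addr0 -c0; ring.
Qed.

Lemma dotv_multiplier_rho2 (t : R) : euler_lagrange T c sigma S z lambda ->
  t \in `]0, T[ -> derivable (rho z) t 1 ->
  dotv ('D_1 lambda t) (rho2 z t) = 0.
Proof.
move=> el tT drho; apply: big1 => i _; rewrite mxE.
have tlam := el_derivable el tT.
have dl := is_derive_coord _ _ _ i 0 tlam.
have dr := is_derive_coord _ _ _ i 0 drho.
pose g := (fun x => c i 0 + lambda x i 0) * (fun x => rho z x i 0).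
have e0 x : x \in `]0, T[ -> g x = 0.
  by move=> xT; have /colP/(_ i) := el_rho el xT; rewrite !mxE.
have dg : is_derive t 1 g ((c i 0 + lambda t i 0) *: 'D_1 (rho z) t i 0
    + rho z t i 0 *: (0 + 'D_1 lambda t i 0)) by exact: is_deriveM.
have g'0 : 'D_1 g t = 0.
  (* A derivative depends only on values near [t], and the open interval is a neighbourhood of
     [t]. *)
  rewrite (@near_eq_derive _ _ _ g (cst 0)) ?derive_cst//.
  near=> x; apply: e0; near: x; exact: near_in_itvoo.
have := @derive_val _ _ _ _ _ _ _ dg.
rewrite g'0 add0r /GRing.scale/= => e1.
have := e0 t tT; rewrite /g fctE /= => e2.
(* In coordinate i this is lambda' rho^2 = rho g' - g rho'. There is no division by rho, which may
   vanish. *)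
have -> : 'D_1 lambda t i 0 * (rho z t i 0 * rho z t i 0) =
  rho z t i 0 * ((c i 0 + lambda t i 0) * 'D_1 (rho z) t i 0
    + rho z t i 0 * 'D_1 lambda t i 0)
  - ((c i 0 + lambda t i 0) * rho z t i 0) * 'D_1 (rho z) t i 0 by ring.
by rewrite -e1 e2 mulr0 mul0r subr0.
Unshelve. all: by end_near. Qed.

(** Since (c + lambda) rho = 0, [sigma] times <p + lambda, S> is the Hamiltonian up to sign. In the
    clock d tau = sigma dt the problem is autonomous, hence the conservation law. *)
Lemma is_derive_hamiltonian (t : R) : euler_lagrange T c sigma S z lambda ->
  t \in `]0, T[ ->
  differentiable (fun y : 'cV[R]_n * 'cV[R]_n => S y.1 y.2)
    (inventory z t, price z t) ->
  [/\ derivable (price z) t 1, derivable (inventory z) t 1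
    & derivable (rho z) t 1] ->
  'D_1 (inventory z) t = - (sigma t *: sales S z t) + sigma t *: rho2 z t ->
  dS_dp S (inventory z t) (price z t) \in unitmx ->
  is_derive t 1 (fun x => dotv (price z x + lambda x) (sales S z x)) 0.
Proof.
move=> el tT dS [dp dI drho] balance uA.
have dl := el_derivable el tT.
have dsales := is_derive_demand _ _ _ _ _ dS dI dp.
have dmu : derivable (price z + lambda) t 1 by exact: derivableD.
have dH := is_derive_dotv _ _ _ _ _ dmu (@ex_derive _ _ _ _ _ _ _ dsales).
refine (@is_derive_eq _ _ _ _ _ _ _ _ dH _).
have salesE : 'D_1 (sales S z) t = _ := @derive_val _ _ _ _ _ _ _ dsales.
rewrite deriveD// -[fun x => S _ _]/(sales S z) salesE balance.
have lam_rho := dotv_multiplier_rho2 _ el tT drho.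
rewrite /= fctE dotvDr !dotv_mulmxr.
have -> : (dS_dp S (inventory z t) (price z t))^T *m (price z t + lambda t) =
    - sales S z t.
  by rewrite (el_price el tT) mulmxN mulKVmx// unitmx_tr.
move: lam_rho; rewrite (el_inv el tT).
(* The costate equation reads lambda' = sigma w. The factor [sigma t] is kept in the vanishing
   product, since it may be zero. *)
set w := _^T *m _ => lam_rho.
have lam_rho' : sigma t * dotv w (rho2 z t) = 0 by rewrite -dotvZl.
rewrite !(dotvDl, dotvDr, dotvNl, dotvNr, dotvZl, dotvZr) lam_rho' addr0.
rewrite [dotv (sales _ _ _) _]dotvC.
by ring.
Qed.

End Invariant.

(** The mean value theorem is applied on [[s, t]], which lies inside the open interval, so nothing
    is asked of [f] at [a] and [b]. *)
Lemma is_derive0_itv_const (R : realType) (f : R -> R) (a b : R) :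
  (forall x, x \in `]a, b[ -> is_derive x 1 f 0) ->
  forall s t, s \in `]a, b[ -> t \in `]a, b[ -> f s = f t.
Proof.
move=> df s t; wlog st : s t / s < t => [wl sab tab|sab tab].
  by case: (ltgtP s t) => [st|ts|->//]; [exact: wl|apply/esym; exact: wl].
have sub x : x \in `[s, t] -> x \in `]a, b[.
  rewrite !in_itv/= => /andP[sx xt].
  by rewrite (lt_le_trans _ sx) ?(le_lt_trans xt) ?(itvP sab) ?(itvP tab).
have df' x : x \in `]s, t[ -> is_derive x 1 f 0.
  rewrite in_itv/= => /andP[sx xt].
  by apply: df; apply: sub; rewrite in_itv/= !ltW.
have cf : {within `[s, t], continuous f}.
  apply: derivable_within_continuous => x /sub/df dfx.
  exact: (@ex_derive _ _ _ _ _ _ _ dfx).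
have [x _] := @MVT R f (fun=> 0) s t st df' cf.
by rewrite mul0r => /eqP; rewrite subr_eq0 => /eqP.
Qed.

Theorem theorem2 (R : realType) (n : nat) (T : R) (T_gt0 : 0 < T)
    (c : 'cV[R]_n) (c_ge0 : forall i, 0 <= c i 0)
    (sigma : R -> R) (sigma_density : is_density T sigma)
    (D : set ('cV[R]_n * 'cV[R]_n)) (D_open : open D)
    (S : 'cV[R]_n -> 'cV[R]_n -> 'cV[R]_n)
    (S_diff : forall x : 'cV[R]_n * 'cV[R]_n, D x ->
      differentiable (fun y : 'cV[R]_n * 'cV[R]_n => S y.1 y.2) x)
    (I0 IT : 'cV[R]_n) (z : trajectory R n)
    (z_optimal : optimal T c sigma D S I0 IT z)
    (z_pos : forall t, t \in `]0, T[ ->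
      [/\ posv (inventory z t), posv (price z t) & posv (sales S z t)])
    (Gamma_unit : forall t, t \in `]0, T[ ->
      elasticity S (inventory z t) (price z t) \in unitmx)
    (multiplier_rule : optimal T c sigma D S I0 IT z ->
      exists lambda : R -> 'cV[R]_n, euler_lagrange T c sigma S z lambda) :
  forall s t : R, s \in `]0, T[ -> t \in `]0, T[ ->
    invariant_quantity c S z s = invariant_quantity c S z t.
Proof.
move=> s t sT tT.
have [lambda el] := multiplier_rule z_optimal.
have [adm _] := z_optimal.
have QE x : x \in `]0, T[ -> invariant_quantity c S z x =
    - dotv (price z x + lambda x) (sales S z x).
  move=> xT; have [_ p0 S0] := z_pos x xT.
  by apply: (invariant_quantityE _ el) => //; exact: Gamma_unit.
rewrite !QE//; congr (- _).
apply: (is_derive0_itv_const _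
  (fun x => dotv (price z x + lambda x) (sales S z x)) 0 T) => // x xT.
have [_ p0 S0] := z_pos x xT.
apply: (is_derive_hamiltonian _ el) => //.
- exact/S_diff/(adm_dom adm).
- exact: (adm_derivable adm).
- exact: (adm_balance adm).
(* Invertibility of dS/dp is inherited from that of Gamma. *)
- by case: (invmx_elasticity _ _ _ _ _ p0 S0 (Gamma_unit x xT)).
Qed.
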